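(* Let $\mathbb{F}$ be a field of characteristic $0$, let $\mathbb{V}$ be an $n$-dimensional vector space over $\mathbb{F}$ with a basis $b_1,\dots,b_n$, and let $(\cdot,\cdot)$ be the symmetric nondegenerate bilinear form on $\mathbb{V}$ with $(b_i,b_j)=\delta_{ij}$. Let $\mathbb{A}$ be the ternary algebra on $\mathbb{V}$ with product $[x,y,z]=(y,z)x+(x,z)y+(x,y)z$. Then all degree $2$ identities on $\mathbb{A}$ are a consequence of the total commutativity of the product, by means of a lifting process.
   Context: A degree $2$ monomial in the variables $x_1,\dots,x_5$ is a formal expression in which each variable occurs exactly once and the ternary product occurs exactly twice, i.e. of one of the shapes $[[\cdot,\cdot,\cdot],\cdot,\cdot]$, $[\cdot,[\cdot,\cdot,\cdot],\cdot]$, $[\cdot,\cdot,[\cdot,\cdot,\cdot]]$. A degree $2$ identity on $\mathbb{A}$ is a formal $\mathbb{F}$-linear combination of such monomials that vanishes for all values of $x_1,\dots,x_5$ in $\mathbb{A}$. Total commutativity is the set of identities $[y_{\sigma(1)},y_{\sigma(2)},y_{\sigma(3)}]=[y_1,y_2,y_3]$, $\sigma\in S_3$. A lifting of these to degree $2$ is either (i) an embedding: placing both sides of a total commutativity identity (in three of the variables) as one entry of a triple product whose other two entries are the remaining variables, e.g. $[[a,b,c],d,e]=[[b,a,c],d,e]$; or (ii) a replacement of one variable in a total commutativity identity by a triple product of variables, e.g. $[[a,b,c],d,e]=[[a,b,c],e,d]$. A degree $2$ identity is a consequence of total commutativity by lifting if it is a linear combination of identities obtained by such liftings.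
   Formalization: The dimension n is assumed to be at least 2; the claim fails for n = 0 (every monomial is an identity) and n = 1 (where [[x1,x2,x3],x4,x5] = [[x1,x2,x4],x3,x5] holds but is not a lifting consequence). *)

(* Defs.v *)
From HB Require Import structures.
From mathcomp Require Import all_boot all_order all_fingroup all_algebra.
From mathcomp.multinomials Require Import freeg.

Set Implicit Arguments.
Unset Strict Implicit.
Unset Printing Implicit Defensive.

Import GRing.Theory.
Local Open Scope ring_scope.

Inductive term :=
| Var of 'I_5
| Tri of term & term & term.

Fixpoint term_encode (t : term) : GenTree.tree 'I_5 :=
  match t with
  | Var i => GenTree.Leaf i
  | Tri t0 t1 t2 =>
      GenTree.Node 0 [:: term_encode t0; term_encode t1; term_encode t2]
  end.

Fixpoint term_decode (u : GenTree.tree 'I_5) : option term :=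
  match u with
  | GenTree.Leaf i => Some (Var i)
  | GenTree.Node _ [:: u0; u1; u2] =>
      match term_decode u0, term_decode u1, term_decode u2 with
      | Some t0, Some t1, Some t2 => Some (Tri t0 t1 t2)
      | _, _, _ => None
      end
  | _ => None
  end.

Lemma term_encodeK : pcancel term_encode term_decode.
Proof. by elim=> //= t0 -> t1 -> t2 ->. Qed.

HB.instance Definition _ := Countable.copy term (pcan_type term_encodeK).

Fixpoint vars (t : term) : seq 'I_5 :=
  match t with
  | Var i => [:: i]
  | Tri t0 t1 t2 => vars t0 ++ vars t1 ++ vars t2
  end.

Fixpoint ntri (t : term) : nat :=
  match t with
  | Var _ => 0
  | Tri t0 t1 t2 => (ntri t0 + ntri t1 + ntri t2).+1
  end.

Definition degree2 (t : term) : bool :=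
  (ntri t == 2) && perm_eq (vars t) (enum 'I_5).

Fixpoint eval (V : Type) (op : V -> V -> V -> V) (x : 'I_5 -> V) (t : term) : V :=
  match t with
  | Var i => x i
  | Tri t0 t1 t2 => op (eval op x t0) (eval op x t1) (eval op x t2)
  end.

(* [{freeg term / F}] is the space of formal F-linear combinations of terms,
   and [fglift] is the linear extension of a map defined on terms. *)
Definition degree2_identity (F : fieldType) (V : lmodType F)
    (op : V -> V -> V -> V) (I : {freeg term / F}) : Prop :=
  {in dom I, forall t, degree2 t} /\
  forall x : 'I_5 -> V, fglift (eval op x) I = 0.

Definition tri (u : 'I_3 -> term) : term :=
  Tri (u (inord 0)) (u (inord 1)) (u (inord 2)).

(* The variables [z], except that entry [k] is replaced by [t]
   (so [z k] is irrelevant). *)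
Definition entry (k : 'I_3) (t : term) (z : 'I_3 -> 'I_5) (i : 'I_3) : term :=
  if i == k then t else Var (z i).

(* [lifting l r] : the degree 2 identity [l = r] is a lifting of a total
   commutativity identity [tri (y \o s) = tri y].  The hypothesis [degree2]
   forces the five variables involved to be pairwise distinct. *)
Inductive lifting : term -> term -> Prop :=
| Embedding (s : 'S_3) (y : 'I_3 -> 'I_5) (k : 'I_3) (z : 'I_3 -> 'I_5) :
    degree2 (tri (entry k (tri (fun i => Var (y i))) z)) ->
    lifting (tri (entry k (tri (fun i => Var (y (s i)))) z))
            (tri (entry k (tri (fun i => Var (y i))) z))
| Replacement (s : 'S_3) (y : 'I_3 -> 'I_5) (k : 'I_3) (z : 'I_3 -> 'I_5) :
    degree2 (tri (entry k (tri (fun i => Var (y i))) z)) ->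
    lifting (tri (fun i => entry k (tri (fun j => Var (y j))) z (s i)))
            (tri (entry k (tri (fun i => Var (y i))) z)).

Definition consequence_by_lifting (F : fieldType) (I : {freeg term / F}) : Prop :=
  exists L : seq (F * (term * term)),
    (forall p, p \in L -> lifting p.2.1 p.2.2) /\
    I = \sum_(p <- L) p.1 *: (<< p.2.1 >> - << p.2.2 >>).

(* When dim V = 1 and (b, b) = 1, [x b, y b, z b] = 3 x y z b satisfies
   [[x1,x2,x3],x4,x5] = [[x1,x2,x4],x3,x5], which is not a
   consequence of total commutativity: liftings preserve the set of variables
   of the inner product.  Hence dim V >= 2 has to be assumed. *)
Definition ternary_product (F : fieldType) (V : lmodType F)
    (form : V -> V -> F) (x y z : V) : V :=
  form y z *: x + form x z *: y + form x y *: z.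

(* Main.v *)
Require Import Defs.
From mathcomp Require Import all_boot all_order all_fingroup all_algebra.
From mathcomp.multinomials Require Import freeg.
From mathcomp Require Import ring.

Set Implicit Arguments.
Unset Strict Implicit.
Unset Printing Implicit Defensive.

Import GRing.Theory.
Local Open Scope ring_scope.

(** Using total commutativity, every degree 2 monomial can be brought to the form
    [[a,b,c],d,e], where moreover a, b, c may be permuted freely, and so may
    d, e. So modulo liftings a monomial is determined by its outer pair {d,e},
    the pair of variables outside the inner product ([linked_outer]). Grouping
    the terms of an identity by outer pair, it remains to see that in each group
    the coefficients sum to zero ([consequence_zero_sum]); equivalently, that
    the ten polynomial maps [[a,b,c],d,e], one for each pair {d,e}, are linearly
    independent.

    This is where two orthonormal vectors u and v are used. Substitute v for the
    variables in a set T and u for the others. The product of three vectors of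
    {u, v} is a multiple of u or v, so [[a,b,c],d,e] takes the value
    A_T(d,e) u or A_T(d,e) v according to the parity of the size of T, with
      - A_T = 9 if T is empty;
      - A_{i} = 3 if i is in {d,e}, and 1 otherwise;
      - A_{i,j} = 1 if exactly one of i, j is in {d,e}, and 3 otherwise.
    Hence the integer combination
      9 (A_{i,j} + A_{i} + A_{j}) - 5 A_empty
    equals 36 if {d,e} = {i,j} and 0 for each of the nine other pairs
    ([pair_probeE]). As this combination is linear in the identity, it
    computes 36 times the coefficient sum of the group {i,j}, which therefore
    vanishes in characteristic zero. *)

(** * Degree 2 monomials *)

Definition nest (a b c d e : 'I_5) : term :=
  Tri (Tri (Var a) (Var b) (Var c)) (Var d) (Var e).

Definition outer (t : term) : {set 'I_5} :=
  if t is Tri t0 t1 t2 then [set i | Var i \in [:: t0; t1; t2]] else set0.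

Lemma Var_eq i j : (Var i == Var j) = (i == j).
Proof. by apply/eqP/eqP=> [[]|->]. Qed.

Lemma outer_nest a b c d e : outer (nest a b c d e) = [set d; e].
Proof. by apply/setP=> i; rewrite !inE !Var_eq. Qed.

(** Liftings are indexed by permutations of ['I_3]; this produces one from a
    rearrangement of three explicit entries. *)
Lemma perm_eq3P (T : eqType) (x0 x1 x2 y0 y1 y2 : T) :
  perm_eq [:: x0; x1; x2] [:: y0; y1; y2] ->
  exists s : 'S_3, let f (i : 'I_3) := nth y0 [:: y0; y1; y2] (s i) in
    [/\ x0 = f (inord 0), x1 = f (inord 1) & x2 = f (inord 2)].
Proof.
case/(@tuple_permP _ _ _ [tuple y0; y1; y2]) => s def_x; exists s => /=.
have nth_x m : (m < 3)%N ->
    nth y0 [:: x0; x1; x2] m = nth y0 [:: y0; y1; y2] (s (inord m)).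
  move=> lt_m3; rewrite def_x -[in LHS](inordK lt_m3) -tnth_nth tnth_mktuple.
  by rewrite (tnth_nth y0).
by split; [have := nth_x 0 isT | have := nth_x 1 isT | have := nth_x 2 isT].
Qed.

Lemma degree2_nest a b c d e :
  degree2 (nest a b c d e) = perm_eq [:: a; b; c; d; e] (enum 'I_5).
Proof. by []. Qed.

Lemma degree2_arrangement t : degree2 t -> exists a b c d e,
  degree2 (nest a b c d e) /\
  let w := Tri (Var a) (Var b) (Var c) in
  t \in [:: Tri w (Var d) (Var e); Tri (Var d) w (Var e);
            Tri (Var d) (Var e) w].
Proof.
(* The two products leave exactly one of the three entries a product. *)
have ntri0 s : ntri s = 0%N -> exists i, s = Var i by case: s => // i; exists i.
have ntri1 s : ntri s = 1%N -> exists a b c, s = Tri (Var a) (Var b) (Var c).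
  case: s => //= t0 t1 t2 [] /eqP; rewrite !addn_eq0 => /andP[/andP[]].
  move=> /eqP/ntri0[a ->] /eqP/ntri0[b ->] /eqP/ntri0[c ->].
  by exists a, b, c.
case: t => // t0 t1 t2; rewrite /degree2 => /andP[/= /eqP[]].
case n0: (ntri t0) => [|[|n]]; last by [].
  case n1: (ntri t1) => [|[|n]]; last by [].
    have [d ->] := ntri0 _ n0; have [e ->] := ntri0 _ n1.
    move=> /ntri1[a [b [c ->]]] /= perm_t; exists a, b, c, d, e.
    rewrite !inE eqxx !orbT; split=> //; apply: perm_trans perm_t.
    by rewrite (perm_catC [:: a; b; c] [:: d; e]).
  case n2: (ntri t2) => [|n]; last by [].
  have [d ->] := ntri0 _ n0; have [e ->] := ntri0 _ n2.
  have [a [b [c ->]]] := ntri1 _ n1 => _ /= perm_t; exists a, b, c, d, e.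
  rewrite !inE eqxx !orbT; split=> //; apply: perm_trans perm_t.
  by rewrite (perm_catCA [:: a; b; c] [:: d] [:: e]).
move/eqP; rewrite eqSS addn_eq0 => /andP[/eqP/ntri0[d ->] /eqP/ntri0[e ->]].
have [a [b [c ->]]] := ntri1 _ n0 => /= perm_t; exists a, b, c, d, e.
by rewrite !inE eqxx.
Qed.

(** * Liftings between monomials with the same outer pair *)

Lemma lifting_inner a b c a' b' c' d e :
  perm_eq [:: a'; b'; c'] [:: a; b; c] -> degree2 (nest a b c d e) ->
  lifting (nest a' b' c' d e) (nest a b c d e).
Proof.
case/perm_eq3P=> s [-> -> ->] deg_t.
pose y (i : 'I_3) := nth a [:: a; b; c] i.
(* The product occupies entry 0, so the value [z 0 = a] is never read. *)
pose z (i : 'I_3) := nth a [:: a; d; e] i.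
have tri_y : tri (fun i => Var (y i)) = Tri (Var a) (Var b) (Var c).
  by rewrite /tri /y !inordK.
have tri_z w : tri (entry (inord 0) w z) = Tri w (Var d) (Var e).
  by rewrite /tri /entry /z -!val_eqE /= !inordK.
by have := @Embedding s y (inord 0) z; rewrite !tri_z tri_y; apply.
Qed.

Lemma lifting_outer a b c d e t0 t1 t2 :
  perm_eq [:: t0; t1; t2] [:: Tri (Var a) (Var b) (Var c); Var d; Var e] ->
  degree2 (nest a b c d e) -> lifting (Tri t0 t1 t2) (nest a b c d e).
Proof.
case/perm_eq3P=> s [-> -> ->] deg_t.
pose y (i : 'I_3) := nth a [:: a; b; c] i.
pose z (i : 'I_3) := nth a [:: a; d; e] i.
have tri_y : tri (fun i => Var (y i)) = Tri (Var a) (Var b) (Var c).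
  by rewrite /tri /y !inordK.
have entry_z w i : entry (inord 0) w z i = nth w [:: w; Var d; Var e] i.
  by rewrite /entry -val_eqE /= inordK //; case: i => -[|[|[|]]].
have := @Replacement s y (inord 0) z.
by rewrite tri_y /tri !entry_z !inordK //; apply.
Qed.

(** Everything needed about an arbitrary monomial can be read off a normal form
    [[a,b,c],d,e]: liftings identify the two, and a totally commutative product,
    here given by the two generating transpositions, does not tell them
    apart. *)
Lemma degree2_normal t : degree2 t -> exists a b c d e,
  [/\ degree2 (nest a b c d e), lifting t (nest a b c d e), d != e,
      outer t = [set d; e] &
      forall (V : Type) (op : V -> V -> V -> V) x,
        (forall u v w, op u v w = op v u w) ->
        (forall u v w, op u v w = op u w v) ->
        eval op x t = eval op x (nest a b c d e)].
Proof.
case/degree2_arrangement=> a [b [c [d [e [deg_n arr_t]]]]].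
have neq_de : d != e.
  have := enum_uniq 'I_5; rewrite -(perm_uniq deg_n).
  rewrite (cat_uniq [:: a; b; c] [:: d; e]).
  by move=> /and3P[_ _]; rewrite /= inE andbT.
exists a, b, c, d, e; rewrite -(outer_nest a b c).
move: arr_t => /=; rewrite !inE => /or3P[] /eqP->; split=> //.
- exact: lifting_outer.
- by apply: lifting_outer => //; apply/seq.permP=> p /=; rewrite addnCA.
- apply: lifting_outer => //; apply/seq.permP=> p /=.
  by rewrite !addn0 addnA addnC.
- by move=> V op x swap12 swap23 /=; rewrite swap23 swap12.
Qed.

(** * The span of the liftings *)

Section Consequences.

Variable F : fieldType.
Implicit Types I J : {freeg term / F}.

Lemma freegZ (k : F) (t : term) :
  << k *g t >> = k *: << t >> :> {freeg term / F}.
Proof. by apply/eqP/freeg_eqP=> x; rewrite coeffZ !coeffU mul1r. Qed.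

Lemma fglift_dom (M : lmodType F) (f : term -> M) I :
  fglift f I = \sum_(t <- dom I) coeff t I *: f t.
Proof. by rewrite -[in LHS](Freeg_dom I) fglift_Freeg /prelift big_map. Qed.

Lemma consequence0 : consequence_by_lifting (0 : {freeg term / F}).
Proof. by exists [::]; rewrite big_nil. Qed.

Lemma consequenceD I J : consequence_by_lifting I ->
  consequence_by_lifting J -> consequence_by_lifting (I + J).
Proof.
move=> [L [liftL ->]] [M [liftM ->]]; exists (L ++ M); rewrite big_cat.
by split=> // p; rewrite mem_cat => /orP[/liftL|/liftM].
Qed.

Lemma consequenceZ k I :
  consequence_by_lifting I -> consequence_by_lifting (k *: I).
Proof.
move=> [L [liftL ->]]; exists [seq (k * p.1, p.2) | p <- L]; split.
  by move=> _ /mapP[p /liftL liftp ->].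
rewrite big_map scaler_sumr; apply: eq_bigr => p _ /=.
by rewrite scalerA.
Qed.

Lemma consequence_sum (K : Type) (r : seq K) (P : pred K) f :
  (forall k, P k -> consequence_by_lifting (f k)) ->
  consequence_by_lifting (\sum_(k <- r | P k) f k : {freeg term / F}).
Proof.
move=> consf; apply: big_ind => //; first exact: consequence0.
exact: consequenceD.
Qed.

Definition linked (l r : term) : Prop :=
  consequence_by_lifting (<< l >> - << r >> : {freeg term / F}).

Lemma lifting_linked l r : lifting l r -> linked l r.
Proof.
move=> lift_lr; exists [:: (1, (l, r))]; rewrite big_seq1 scale1r.
by split=> // p; rewrite inE => /eqP->.
Qed.

Lemma linked_sym l r : linked l r -> linked r l.
Proof. by move/(consequenceZ (-1)); rewrite scaleN1r opprB. Qed.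

Lemma linked_trans s l r : linked l s -> linked s r -> linked l r.
Proof. by move=> ls sr; have := consequenceD ls sr; rewrite addrA subrK. Qed.

(** Compare two normal forms by rearranging first the outer and then the inner
    variables. Once the outer pairs agree, so do the inner triples, since both
    monomials use every variable exactly once. *)
Lemma linked_outer t t' :
  degree2 t -> degree2 t' -> outer t = outer t' -> linked t t'.
Proof.
move=> /degree2_normal[a [b [c [d [e [deg_n lift_t neq_de -> _]]]]]].
move=> /degree2_normal[a' [b' [c' [d' [e' [deg_n' lift_t' neq_de' -> _]]]]]].
move=> eq_out.
have perm_n : perm_eq [:: a; b; c; d; e] [:: a'; b'; c'; d'; e'].
  by move: deg_n; rewrite degree2_nest => /perm_trans->; rewrite // perm_sym.
have perm_de : perm_eq [:: d'; e'] [:: d; e].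
  apply: uniq_perm; rewrite /= ?inE ?andbT //.
  by move=> i; have /setP/(_ i) := eq_out; rewrite !inE.
have perm_abc : perm_eq [:: a; b; c] [:: a'; b'; c'].
  rewrite -(perm_cat2r [:: d'; e']); apply: perm_trans perm_n.
  by rewrite (perm_cat2l [:: a; b; c] [:: d'; e'] [:: d; e]).
(* The intermediate monomial takes its inner triple from [t] and its outer pair,
   in order, from [t']. *)
have link_outer : linked (nest a b c d' e') (nest a b c d e).
  apply/lifting_linked/lifting_outer; rewrite // perm_cons.
  exact: (perm_map Var perm_de).
have link_inner : linked (nest a b c d' e') (nest a' b' c' d' e').
  exact/lifting_linked/lifting_inner.
apply: linked_trans (lifting_linked lift_t) _.
apply: linked_trans (linked_sym link_outer) _.
apply: linked_trans link_inner _.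
exact/linked_sym/lifting_linked.
Qed.

(** Subtracting one fixed member of the class from every term changes nothing,
    because the coefficients sum to zero, and exhibits the combination as one of
    differences of linked monomials. *)
Lemma consequence_zero_sum (r : seq term) (P : pred term) (k : term -> F) :
  (forall t t', P t -> P t' -> linked t t') -> \sum_(t <- r | P t) k t = 0 ->
  consequence_by_lifting (\sum_(t <- r | P t) k t *: << t >>).
Proof.
move=> linkP sum0.
have [/hasP[t0 _ Pt0]|/hasPn noP] := boolP (has P r); last first.
  rewrite big_seq_cond big_pred0; first exact: consequence0.
  by move=> t; apply/andP=> -[/noP/negP].
have -> : \sum_(t <- r | P t) k t *: << t >> =
          \sum_(t <- r | P t) k t *: (<< t >> - << t0 >>) :> {freeg term / F}.
  under [RHS]eq_bigr do rewrite scalerBr.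
  by rewrite sumrB -scaler_suml sum0 scale0r subr0.
by apply: consequence_sum => t Pt; apply/consequenceZ/linkP.
Qed.

End Consequences.

(** * Separating the outer pairs by substitutions *)

Section TernaryProduct.

Variables (F : fieldType) (V : lmodType F) (form : {symmetric V}).
Local Notation op := (ternary_product form).

Lemma formC x y : form x y = form y x.
Proof. by rewrite hermC mul1r. Qed.

Lemma ternary_productC x y z : op x y z = op y x z.
Proof. by rewrite /ternary_product [form y x]formC [_ + form x z *: _]addrC. Qed.

Lemma ternary_productAC x y z : op x y z = op x z y.
Proof. by rewrite /ternary_product [form z y]formC addrAC. Qed.

Lemma ternary_productZl k x y z : op (k *: x) y z = k *: op x y z.
Proof.
rewrite /ternary_product !linearZl_LR /= !scalerDr !scalerA.
by rewrite [form y z * k]mulrC.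
Qed.

Variables u v : V.
Hypotheses (uu1 : form u u = 1) (vv1 : form v v = 1) (uv0 : form u v = 0).

Definition vec (p : bool) : V := if p then v else u.

(** A product of three vectors of the orthonormal pair is 3 times the vector when
    they coincide; otherwise the two equal ones contract to 1 and leave the odd
    one out, which is the exclusive or of the three. *)
Definition weight (p q r : bool) : F := if (p == q) && (q == r) then 3 else 1.

Lemma form_vec p q : form (vec p) (vec q) = (p == q)%:R.
Proof. by case: p q => [] [] //=; rewrite formC. Qed.

Lemma ternary_product_vec p q r :
  op (vec p) (vec q) (vec r) = weight p q r *: vec (p (+) q (+) r).
Proof.
rewrite /ternary_product !form_vec.
by case: p q r => [] [] []; rewrite /weight /=
  ?(scale1r, scale0r, addr0, add0r) // scaler_nat mulrS mulr2n addrA.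
Qed.

(** Substitute [v] for the variables of [T] and [u] for the others; the value of
    a degree 2 monomial is then a multiple of [u] or [v], depending on the parity
    of [T], and this is the multiplier. *)
Definition axis_coeff (T : pred 'I_5) (t : term) : F :=
  form (eval op (fun k => vec (T k)) t) (vec (odd #|T|)).

(** The inner product is again a multiple of [u] or [v], so the rule for
    triples of basis vectors applies a second time. *)
Lemma axis_coeff_nest (T : pred 'I_5) a b c d e : degree2 (nest a b c d e) ->
  axis_coeff T (nest a b c d e) =
    weight (T a) (T b) (T c) *
    weight (T a (+) T b (+) T c) (T d) (T e).
Proof.
rewrite degree2_nest => perm_n.
rewrite /axis_coeff /= ternary_product_vec ternary_productZl.
rewrite ternary_product_vec !linearZl_LR /= form_vec.
have -> : #|T| = count T [:: a; b; c; d; e].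
  by rewrite [RHS](seq.permP perm_n T) cardE size_filter enumT.
by rewrite /= !oddD !oddb addbF -!addbA eqxx mulr1.
Qed.

(** With p and q telling whether i and j are outer variables, the multipliers are
      A_empty = 9, A_{i} = 1 + 2p, A_{j} = 1 + 2q, A_{i,j} = 3 - 2p - 2q + 4pq,
    so that A_{i,j} + A_{i} + A_{j} = 5 + 4pq; subtracting 5/9 of A_empty isolates
    4pq. The factor 9 clears the denominator. *)
Definition pair_probe (i j : 'I_5) (t : term) : F :=
  9 * (axis_coeff (pred2 i j) t +
       axis_coeff (pred1 i) t + axis_coeff (pred1 j) t)
  - 5 * axis_coeff pred0 t.

Lemma pair_probeE i j t : i != j -> degree2 t ->
  pair_probe i j t = 36 * (outer t == [set i; j])%:R.
Proof.
move=> neq_ij /degree2_normal[a [b [c [d [e [deg_n _ _ -> evalt]]]]]].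
rewrite /pair_probe /axis_coeff.
rewrite !(evalt _ _ _ ternary_productC ternary_productAC) -!/(axis_coeff _ _) !axis_coeff_nest //.
(* Each of i, j is exactly one of a, b, c, d, e, and they are different ones;
   this leaves 20 of the 2^10 truth assignments. *)
have one_eq k :
    ((a == k) + ((b == k) + ((c == k) + ((d == k) + ((e == k) + 0)))) = 1)%N.
  have /= -> := seq.permP deg_n (pred1 k).
  by rewrite count_uniq_mem ?enum_uniq // mem_enum.
have both_eq k : (k == i) && (k == j) = false.
  by case: eqP => // ->; apply: negbTE.
have -> : ([set d; e] == [set i; j]) =
          ((d == i) || (e == i)) && ((d == j) || (e == j)).
  rewrite eq_sym eqEcard subUset !sub1set !cards2 neq_ij !inE.
  by rewrite ![i == _]eq_sym ![j == _]eq_sym; case: (d != e); rewrite andbT.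
rewrite /=; move: (one_eq i) (one_eq j).
move: (both_eq a) (both_eq b) (both_eq c) (both_eq d) (both_eq e).
move: (a == i) (b == i) (c == i) (d == i) (e == i) => [] [] [] [] [] //.
all: move: (a == j) (b == j) (c == j) (d == j) (e == j) => [] [] [] [] [] //.
all: by move=> *; rewrite /weight /=; ring.
Qed.

End TernaryProduct.

(** * Degree 2 identities of the ternary product *)

Theorem lemma9 (F : fieldType) (charF0 : [pchar F] =i pred0)
  (V : vectType F) (n : nat) (n_gt1 : (1 < n)%N)
  (b : n.-tuple V) (b_basis : basis_of fullv b)
  (form : {symmetric V}) (form_nondeg : nondegenerate form)
  (form_b : forall i j : 'I_n, form (tnth b i) (tnth b j) = (i == j)%:R)
  (I : {freeg term / F}) :
  degree2_identity (ternary_product form) I -> consequence_by_lifting I.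
Proof.
move=> [degI idI].
have lt0n : (0 < n)%N by exact: ltnW.
pose u := tnth b (Ordinal lt0n); pose v := tnth b (Ordinal n_gt1).
have uu1 : form u u = 1 by rewrite form_b eqxx.
have vv1 : form v v = 1 by rewrite form_b eqxx.
have uv0 : form u v = 0 by rewrite form_b.
(* All the multipliers are linear functionals of the evaluations, which vanish
   on the identity. *)
have axis0 (T : pred 'I_5) :
    \sum_(t <- dom I) coeff t I * axis_coeff form u v T t = 0.
  pose x k := vec u v (T k).
  transitivity (form (fglift (eval (ternary_product form) x) I)
                     (vec u v (odd #|T|))); last by rewrite idI linear0l.
  rewrite fglift_dom linear_sumlz; apply: eq_bigr => t _.
  by rewrite linearZl_LR.
rewrite -(freeg_sumE I) (eq_bigr _ (fun t _ => freegZ _ t)) big_seq.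
rewrite (partition_big outer (fun P => #|P| == 2)) => [|t /degI deg_t];
  last first.
  have [a [a' [c [d [e [_ _ neq_de -> _]]]]]] := degree2_normal deg_t.
  by rewrite cards2 neq_de.
apply: consequence_sum => P /cards2P[i [j [neq_ij ->]]].
apply: consequence_zero_sum.
  move=> t t' /andP[dom_t /eqP out_t] /andP[dom_t' /eqP out_t'].
  by apply: linked_outer; [apply: degI | apply: degI | rewrite out_t].
have nz36 : 36 != 0 :> F by rewrite ((pcharf0P F).1 charF0).
apply: (mulfI nz36); rewrite mulr0 mulr_sumr -big_seq_cond big_mkcond /=.
transitivity (\sum_(t <- dom I) coeff t I * pair_probe form u v i j t).
  apply: eq_big_seq => t dom_t.
  rewrite (pair_probeE uu1 vv1 uv0 neq_ij (degI t dom_t)).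
  by case: eqP => _; rewrite ?mulr1 ?mulr0 // mulrC.
have dist t : coeff t I * pair_probe form u v i j t =
    9 * (coeff t I * axis_coeff form u v (pred2 i j) t +
         coeff t I * axis_coeff form u v (pred1 i) t +
         coeff t I * axis_coeff form u v (pred1 j) t)
    - 5 * (coeff t I * axis_coeff form u v pred0 t).
  by rewrite /pair_probe; ring.
under eq_bigr do rewrite dist.
by rewrite sumrB -!mulr_sumr !big_split /= !axis0; ring.
Qed.
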